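(* Let $k\ge 2$ be an integer and let $\Delta^{(0)}=(z_0^{(0)},z_1^{(0)},z_2^{(0)})$ be a spheric triangle with circumcenter $c$ and associated angle vector $\alpha^{(0)}=(\alpha_0^{(0)},\alpha_1^{(0)},\alpha_2^{(0)})$. Let $$A=\begin{pmatrix}\frac{k-1}{k}&\frac1k&0\\0&\frac{k-1}{k}&\frac1k\\\frac1k&0&\frac{k-1}{k}\end{pmatrix},$$ put $\alpha^{(n)}=A^n\alpha^{(0)}$ for $n\ge 0$, and let $\Delta^{(n)}$ be the spheric triangle with angle vector $\alpha^{(n)}$ constructed around $c$. Then the sequence $\Delta^{(n)}$ converges to a regular triangle.
   Context: A spheric triangle is a triple $(z_0,z_1,z_2)$ of points of the unit sphere $\mathbb{S}^2\subset\mathbb{R}^3$, its vertices, counted counterclockwise. Every spheric triangle has a circumscribed circle on the sphere; its center $c\in\mathbb{S}^2$ is the circumcenter. For $j\in\mathbb{Z}/3\mathbb{Z}$, the angle $\alpha_j$ is the angle at $c$ between the directions to $z_j$ and $z_{j+1}$, i.e. the angle of the counterclockwise rotation around the axis $c$ that takes $z_j$ to $z_{j+1}$; thus $\alpha_0+\alpha_1+\alpha_2=2\pi$. The triangle $\Delta^{(n)}$ with angle vector $\alpha^{(n)}$ constructed around $c$ has its vertices $z_j^{(n)}$ on the circle on the sphere around $c$ of radius $\|c-z_j^{(0)}\|$ (the circumscribed circle of $\Delta^{(0)}$), with consecutive angles $\alpha^{(n)}_0,\alpha^{(n)}_1,\alpha^{(n)}_2$ around $c$. (The transformation $\alpha\mapsto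 A\alpha$ is the one induced on angles by rotating each vertex $z_j$ around $c$ by $\alpha_j/k$.) A sequence of such triangles converges to a regular spheric triangle if its vectors of angles $(\alpha_0,\alpha_1,\alpha_2)\in\mathbb{R}^3$ converge to $(\frac{2\pi}{3},\frac{2\pi}{3},\frac{2\pi}{3})$ in the Euclidean norm. *)

(* Defs.v *)
From HB Require Import structures.
From mathcomp Require Import all_boot all_order all_algebra.
From mathcomp Require Import all_classical all_reals all_analysis.

Set Implicit Arguments.
Unset Strict Implicit.
Unset Printing Implicit Defensive.

Import Order.TTheory GRing.Theory Num.Theory.
Import numFieldNormedType.Exports.

Local Open Scope classical_set_scope.
Local Open Scope ring_scope.

Definition dot (R : realType) (u v : 'cV[R]_3) : R := \sum_i u i 0 * v i 0.

(* The Euclidean norm: the library norm on matrices is the maximum norm. *)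
Definition enorm (R : realType) (u : 'cV[R]_3) : R := Num.sqrt (dot u u).

(* Here, as in the rest of the file, the indices 'I_3 are added modulo 3. *)
Definition cross (R : realType) (u v : 'cV[R]_3) : 'cV[R]_3 :=
  \col_i (u (i + 1) 0 * v (i + 2) 0 - u (i + 2) 0 * v (i + 1) 0).

Definition on_sphere (R : realType) (z : 'cV[R]_3) : Prop := enorm z = 1.

(* Rodrigues' formula: the rotation by t around the axis spanned by the unit
   vector c, counterclockwise for an observer outside the sphere above c. *)
Definition rotation (R : realType) (c : 'cV[R]_3) (t : R) (z : 'cV[R]_3) :
    'cV[R]_3 :=
  cos t *: z + sin t *: cross c z + ((1 - cos t) * dot c z) *: c.

Definition spheric_triangle (R : realType) (T : 'I_3 -> 'cV[R]_3) : Prop :=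
  (forall j, on_sphere (T j)) /\ injective T.

Definition counterclockwise_around (R : realType) (c : 'cV[R]_3)
    (T : 'I_3 -> 'cV[R]_3) : Prop :=
  0 < dot c (cross (T 1 - T 0) (T 2 - T 0)).

(* Both poles of the circumscribed circle are equidistant from the vertices;
   the circumcenter is the one around which the vertices are listed
   counterclockwise. *)
Definition circumcenter (R : realType) (T : 'I_3 -> 'cV[R]_3)
    (c : 'cV[R]_3) : Prop :=
  [/\ on_sphere c,
      forall i j, enorm (c - T i) = enorm (c - T j) &
      counterclockwise_around c T].

(* The angle is normalized to [0, 2 pi[; it is unique when z and w are points
   of a common circle around c that does not reduce to a point. *)
Definition rotation_angle (R : realType) (c z w : 'cV[R]_3) : R :=
  xget 0 [set t : R | 0 <= t < 2 * pi /\ rotation c t z = w].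

Definition angle_vector (R : realType) (c : 'cV[R]_3)
    (T : 'I_3 -> 'cV[R]_3) : 'cV[R]_3 :=
  \col_j rotation_angle c (T j) (T (j + 1)).

Definition angle_matrix (R : realType) (k : nat) : 'M[R]_3 :=
  \matrix_(i, j) (if j == i then (k%:R - 1) / k%:R
                  else if j == i + 1 then 1 / k%:R else 0).

(* T is a spheric triangle with angle vector a constructed around c, on the
   circle at chordal distance r from c. Such a T is unique only up to rotation
   around c. *)
Definition constructed_around (R : realType) (c : 'cV[R]_3) (r : R)
    (a : 'cV[R]_3) (T : 'I_3 -> 'cV[R]_3) : Prop :=
  [/\ spheric_triangle T, circumcenter T c,
      forall j, enorm (c - T j) = r & angle_vector c T = a].

Definition converges_to_regular (R : realType) (c : 'cV[R]_3)
    (D : nat -> 'I_3 -> 'cV[R]_3) : Prop :=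
  enorm (angle_vector c (D n) - const_mx (2 * pi / 3)) @[n --> \oo] --> (0 : R).

(* Main.v *)
(** For a unit vector [c], rotations around [c] add their angles and act freely,
    modulo [2 pi], on the points of the sphere not on the axis. The three angles
    of a triangle thus sum to [2 pi] or [4 pi], and the counterclockwise
    condition, which reads [0 < sin a0 + sin a1 - sin (a0 + a1)], selects [2 pi]
    because the right-hand side is
    [4 sin (a0 / 2) sin (a1 / 2) sin ((a0 + a1) / 2)]. The matrix [A] preserves
    positivity and the sum of the angles, hence the triangles exist. It fixes
    the constant vectors and multiplies the squared norm of any vector of sum
    zero by exactly [1 - 3 (1 - 1/k) / k], which lies in [[1/4, 1)]. *)
Require Import Defs.
From HB Require Import structures.
From mathcomp Require Import all_boot all_order all_algebra.
From mathcomp Require Import all_classical all_reals all_analysis.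
From mathcomp Require Import ring lra.

Set Implicit Arguments.
Unset Strict Implicit.
Unset Printing Implicit Defensive.

Import Order.TTheory GRing.Theory Num.Theory.
Import numFieldNormedType.Exports.

Local Open Scope classical_set_scope.
Local Open Scope ring_scope.

(** * Arithmetic of indices modulo 3 *)

Lemma ord3P (i : 'I_3) : [\/ i = 0, i = 1 | i = 2].
Proof.
case: i => [[|[|[|//]]] ?]; [constructor 1|constructor 2|constructor 3];
  exact/val_inj.
Qed.

Lemma ord3D : ((1 + 1 = 2 :> 'I_3)%R * (1 + 2 = 0 :> 'I_3)%R *
  (2 + 1 = 0 :> 'I_3)%R * (2 + 2 = 1 :> 'I_3)%R)%type.
Proof. by do !split; apply/val_inj. Qed.

Lemma sum_ord3 (V : zmodType) (F : 'I_3 -> V) : \sum_i F i = F 0 + F 1 + F 2.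
Proof.
by rewrite !big_ord_recr big_ord0 /= add0r; congr (F _ + F _ + F _); apply/val_inj.
Qed.

(** * Inner and cross products in three-space *)

Section Vectors.
Variable R : realType.
Implicit Types (c u v w z : 'cV[R]_3) (s t : R).

Lemma col3P u v : u 0 0 = v 0 0 -> u 1 0 = v 1 0 -> u 2 0 = v 2 0 -> u = v.
Proof. by move=> u0 u1 u2; apply/colP => i; case: (ord3P i) => ->. Qed.

Lemma dot3E u v : dot u v = u 0 0 * v 0 0 + u 1 0 * v 1 0 + u 2 0 * v 2 0.
Proof. exact: sum_ord3. Qed.

Lemma cross3E u v : ((cross u v 0 0 = u 1 0 * v 2 0 - u 2 0 * v 1 0)%R *
  (cross u v 1 0 = u 2 0 * v 0 0 - u 0 0 * v 2 0)%R *
  (cross u v 2 0 = u 0 0 * v 1 0 - u 1 0 * v 0 0)%R)%type.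
Proof. by rewrite /cross !mxE !ord3D !add0r. Qed.

Lemma dotC u v : dot u v = dot v u.
Proof. by rewrite !dot3E; ring. Qed.

Lemma dotDl u v w : dot (u + v) w = dot u w + dot v w.
Proof. by rewrite !dot3E !mxE; ring. Qed.

Lemma dotZl s u v : dot (s *: u) v = s * dot u v.
Proof. by rewrite !dot3E !mxE; ring. Qed.

Lemma dotDr u v w : dot w (u + v) = dot w u + dot w v.
Proof. by rewrite dotC dotDl !(dotC w). Qed.

Lemma dotZr s u v : dot u (s *: v) = s * dot u v.
Proof. by rewrite dotC dotZl dotC. Qed.

Lemma dot_subr2 u v : dot (u - v) (u - v) = dot u u - 2 * dot u v + dot v v.
Proof. by rewrite !dot3E !mxE; ring. Qed.

Lemma dot_ge0 u : 0 <= dot u u.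
Proof. by apply: sumr_ge0 => i _; rewrite -expr2 sqr_ge0. Qed.

Lemma dot_eq0 u : dot u u = 0 -> u = 0.
Proof.
rewrite dot3E => u0.
by apply: col3P; rewrite !mxE; apply/eqP; rewrite -sqrf_eq0; apply/eqP; nra.
Qed.

Lemma enorm_sqr u : enorm u ^+ 2 = dot u u.
Proof. by rewrite sqr_sqrtr ?dot_ge0. Qed.

Lemma on_sphereP u : on_sphere u <-> dot u u = 1.
Proof.
by rewrite -enorm_sqr /on_sphere; split=> [->|/eqP];
  rewrite ?expr1n // sqrp_eq1 ?sqrtr_ge0 // => /eqP.
Qed.

Lemma dotBl u v w : dot (u - v) w = dot u w - dot v w.
Proof. by rewrite !dot3E !mxE; ring. Qed.

Lemma dotBr u v w : dot w (u - v) = dot w u - dot w v.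
Proof. by rewrite dotC dotBl !(dotC w). Qed.

Lemma crossDr u v w : cross w (u + v) = cross w u + cross w v.
Proof. by apply: col3P; rewrite !(cross3E, mxE); ring. Qed.

Lemma crossBr u v w : cross w (u - v) = cross w u - cross w v.
Proof. by apply: col3P; rewrite !(cross3E, mxE); ring. Qed.

Lemma crossZr s u v : cross u (s *: v) = s *: cross u v.
Proof. by apply: col3P; rewrite !(cross3E, mxE); ring. Qed.

Lemma cross_anti u v : cross u v = - cross v u.
Proof. by apply: col3P; rewrite !(cross3E, mxE); ring. Qed.

Lemma crossvv u : cross u u = 0.
Proof. by apply: col3P; rewrite !(cross3E, mxE); ring. Qed.

Lemma cross_cross u v w : cross u (cross v w) = dot u w *: v - dot u v *: w.
Proof. by apply: col3P; rewrite !(cross3E, mxE) !dot3E; ring. Qed.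

Lemma dot_cross u v w : dot u (cross v w) = dot (cross u v) w.
Proof. by rewrite !dot3E !cross3E; ring. Qed.

Lemma dot_cross_cross u v :
  dot (cross u v) (cross u v) = dot u u * dot v v - dot u v ^+ 2.
Proof. by rewrite !dot3E !cross3E; ring. Qed.

Lemma dot_crossl u v : dot u (cross u v) = 0.
Proof. by rewrite dot3E !cross3E; ring. Qed.

Lemma dot_crossr u v : dot v (cross u v) = 0.
Proof. by rewrite dot3E !cross3E; ring. Qed.

(** Since [u] and [v] are orthogonal to [c], their cross product is a multiple of [c]; expanding
    [cross u (cross u v)] in two ways then gives the coordinates of [v]. *)
Lemma planar_decomposition c u v : dot c c = 1 -> dot c u = 0 -> dot c v = 0 ->
  dot u u *: v = dot u v *: u + dot (cross c u) v *: cross c u.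
Proof.
move=> c1 cu cv; have m0 : cross c (cross u v) = 0.
  by rewrite cross_cross cu cv !scale0r subrr.
have mE : cross u v = dot (cross c u) v *: c.
  have := cross_cross c c (cross u v).
  rewrite m0 c1 scale1r dot_cross => h; apply/esym/eqP.
  by rewrite -subr_eq0 -h -[X in cross c X](scale0r c) crossZr scale0r.
have := cross_cross u u v; rewrite mE crossZr (cross_anti u c) scalerN => h.
by rewrite -[dot u v *: u](subrK (dot u u *: v)) -h addrAC addNr add0r.
Qed.

End Vectors.

(** * Trigonometric identities and the sum of three angles *)

Section Trigonometry.
Variable R : realType.
Implicit Types (s t x y a b : R).

Lemma cos_sin_surj x y : x ^+ 2 + y ^+ 2 = 1 ->
  exists t, [/\ 0 <= t < 2 * pi, cos t = x & sin t = y].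
Proof.
move=> xy1; have x1 : -1 <= x <= 1 by nra.
have pi0 : 0 < pi :> R := pi_gt0 R.
have yE : Num.sqrt (1 - x ^+ 2) = `|y| by rewrite -xy1 addrAC subrr add0r sqrtr_sqr.
have [/andP[a0 api] cE] := acos_def x1; have sE := sin_acos x1.
have [y0|y0] := leP 0 y.
  exists (acos x); split=> //; last by rewrite sE yE ger0_norm.
  by rewrite a0; lra.
(* Here [y < 0] forces [x < 1], so the reflected angle [2 * pi - acos x] stays strictly below
   [2 * pi]. *)
have {}a0 : 0 < acos x by apply: acos_gt0; nra.
exists (2 * pi - acos x); rewrite cosB sinB mulr_natl cos2pi sin2pi cE sE yE.
split; first by rewrite -mulr_natl; lra.
- by ring.
- by rewrite ltr0_norm //; ring.
Qed.

(** The left side is [sin a * (1 - cos b) + sin b * (1 - cos a)]; half-angle formulas make a factor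
    [4 * sin (a / 2) * sin (b / 2)] appear. *)
Lemma sin_half_sum a b :
  sin a + sin b - sin (a + b) = 4 * sin (a / 2) * sin (b / 2) * sin ((a + b) / 2).
Proof.
have sE t : sin t = 2 * sin (t / 2) * cos (t / 2).
  by rewrite [in LHS](splitr t) sinD; ring.
have cE t : cos t = 1 - 2 * sin (t / 2) ^+ 2.
  by rewrite [in LHS](splitr t) cosD -!expr2 cos2sin2; ring.
rewrite (mulrDl a b) !sinD (sE a) (sE b) (cE a) (cE b); ring.
Qed.

(** A cosine equal to 1 makes [sin (t / 2)] vanish, and the sine has only the zero 0 between [- pi]
    and [pi]. *)
Lemma cos_eq1 t : cos t = 1 -> `|t| < 2 * pi -> t = 0.
Proof.
move=> c1; have sin2 : sin (t / 2) = 0.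
  apply/eqP; rewrite -sqrf_eq0 sin2cos2; apply/eqP.
  by move: c1; rewrite [in X in X -> _](splitr t) cosD -!expr2 sin2cos2; lra.
have pi0 : 0 < pi :> R := pi_gt0 R.
rewrite ltr_norml => /andP[tl tr]; have [t0|t0|//] := ltgtP t 0.
- have : 0 < sin (- (t / 2)) by apply: sin_gt0_pi; lra.
  by rewrite sinN sin2 oppr0 ltxx.
- have : 0 < sin (t / 2) by apply: sin_gt0_pi; lra.
  by rewrite sin2 ltxx.
Qed.

Lemma cosB2pi t : cos (t - 2 * pi) = cos t.
Proof. by rewrite cosB mulr_natl cos2pi sin2pi mulr1 mulr0 addr0. Qed.

Lemma angle_sum_2pi a0 a1 a2 :
    0 < a0 < 2 * pi -> 0 < a1 < 2 * pi -> 0 < a2 < 2 * pi ->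
    cos (a0 + a1 + a2) = 1 ->
  (0 < sin a0 + sin a1 - sin (a0 + a1)) = (a0 + a1 + a2 == 2 * pi).
Proof.
move=> /andP[a0l a0r] /andP[a1l a1r] /andP[a2l a2r] cS.
have pi0 : 0 < pi :> R := pi_gt0 R.
have s0 : 0 < sin (a0 / 2) by apply: sin_gt0_pi; lra.
have s1 : 0 < sin (a1 / 2) by apply: sin_gt0_pi; lra.
have s2 : 0 < sin (a2 / 2) by apply: sin_gt0_pi; lra.
rewrite sin_half_sum -!mulrA !pmulr_rgt0 //.
(* The sum lies strictly between 0 and [6 * pi], so it is [2 * pi] or [4 * pi]; the remaining factor
   [sin ((a0 + a1) / 2)] is [sin (a2 / 2)] or its opposite, respectively. *)
have [Slt|Sge] := ltP (a0 + a1 + a2) (4 * pi).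
  have S2 : a0 + a1 + a2 - 2 * pi = 0.
    by apply: cos_eq1; rewrite ?cosB2pi // ltr_norml; lra.
  have -> : (a0 + a1) / 2 = pi - a2 / 2 by lra.
  by rewrite sinB sinpi cospi mul0r sub0r mulN1r opprK s2 -subr_eq0 S2 eqxx.
have S4 : a0 + a1 + a2 - 2 * pi - 2 * pi = 0.
  by apply: cos_eq1; rewrite ?cosB2pi // ltr_norml; lra.
have -> : (a0 + a1) / 2 = 2 * pi - a2 / 2 by lra.
have -> : sin (2 * pi - a2 / 2) = - sin (a2 / 2).
  by rewrite sinB mulr_natl sin2pi cos2pi mul0r sub0r mul1r.
rewrite oppr_gt0.
by rewrite lt_gtF //; case: eqP => // S2; lra.
Qed.

End Trigonometry.

(** * Rotations around a unit axis and the angles of a triangle *)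

Section Rotation.
Variables (R : realType) (c : 'cV[R]_3).
Hypothesis c1 : dot c c = 1.
Implicit Types (u z : 'cV[R]_3) (s t : R).

Lemma dot_rotation t z : dot c (rotation c t z) = dot c z.
Proof. by rewrite !dotDr !dotZr dot_crossl c1; ring. Qed.

Lemma rotationD s t z : rotation c s (rotation c t z) = rotation c (s + t) z.
Proof.
rewrite {1}/rotation dot_rotation /rotation !crossDr !crossZr cross_cross crossvv c1.
by apply/colP => i; rewrite !mxE cosD sinD; ring.
Qed.

Lemma rotation0 z : rotation c 0 z = z.
Proof. by rewrite /rotation cos0 sin0 subrr mul0r !scale0r !addr0 scale1r. Qed.

Lemma rotation2pi z : rotation c (2 * pi) z = z.
Proof.
by rewrite /rotation mulr_natl cos2pi sin2pi subrr mul0r !scale0r !addr0 scale1r.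
Qed.

(** The component along the axis is kept, while the components orthogonal to it make an angle
    [t - s]; [dot z z - dot c z ^+ 2] is the squared radius of the circle through [z]. *)
Lemma dot_rotation2 s t z :
  dot (rotation c s z) (rotation c t z) =
  cos (t - s) * (dot z z - dot c z ^+ 2) + dot c z ^+ 2.
Proof.
rewrite !(dotDl, dotDr, dotZl, dotZr) dot_cross_cross.
rewrite !(dotC _ c) (dotC (cross c z) z) dot_crossl dot_crossr c1 cosB.
ring: (cos2Dsin2 s) (cos2Dsin2 t).
Qed.

Lemma dot_rotationvv t z : dot (rotation c t z) (rotation c t z) = dot z z.
Proof. by rewrite dot_rotation2 subrr cos0; ring. Qed.

(** This evaluates the counterclockwise condition: it is twice the signed area of the triangle with
    vertices at angles 0, [s], [t] on the circle. *)
Lemma dot_cross_rotation s t z :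
  dot c (cross (rotation c s z - z) (rotation c t z - z)) =
  (sin s + sin (t - s) - sin t) * (dot z z - dot c z ^+ 2).
Proof.
rewrite dot_cross crossBr !crossDr !crossZr cross_cross crossvv scaler0 addr0 c1.
rewrite !(dotBl, dotBr, dotDl, dotDr, dotZl, dotZr) dot_cross_cross.
rewrite !(dotC _ c) (dotC (cross c z) z) !(dot_crossl, dot_crossr) c1 sinB.
ring.
Qed.

(** By Lagrange's identity this quantity is the squared norm of [cross c z]. *)
Lemma off_axis_gt0 z : dot z z != dot c z ^+ 2 -> 0 < dot z z - dot c z ^+ 2.
Proof.
move=> z0; rewrite lt_neqAle eq_sym subr_eq0 z0 /=.
by rewrite -[X in X - _]mul1r -c1 -dot_cross_cross dot_ge0.
Qed.

(** The inner product of the two equal points forces [cos (s - t) = 1]. *)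
Lemma rotation_inj s t z : dot z z != dot c z ^+ 2 -> `|s - t| < 2 * pi ->
  rotation c s z = rotation c t z -> s = t.
Proof.
rewrite -subr_eq0 => z0 st rst; apply/eqP; rewrite -subr_eq0; apply/eqP.
apply: cos_eq1 => //; apply: (mulIf z0).
have := dot_rotation2 t s z; rewrite rst dot_rotationvv => h.
by rewrite mul1r [X in _ = X - _]h addrK.
Qed.

Lemma rotation_angleE t z : dot z z != dot c z ^+ 2 -> 0 <= t < 2 * pi ->
  rotation_angle c z (rotation c t z) = t.
Proof.
move=> z0 /andP[t0 t1]; apply: xget_unique => [|s [/andP[s0 s1]]].
  by split=> //; apply/andP.
by apply: rotation_inj => //; rewrite ltr_norml; lra.
Qed.

(** In the plane orthogonal to [c], the vectors [p] and [cross c p] are orthogonal of equal norm, so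
    the coordinates of [q] lie on the unit circle. *)
Lemma planar_polar p q : dot c p = 0 -> dot c q = 0 ->
    dot q q = dot p p -> dot p p != 0 ->
  exists t, 0 <= t < 2 * pi /\ q = cos t *: p + sin t *: cross c p.
Proof.
move=> cp cq qq p0.
have w2 : dot (cross c p) (cross c p) = dot p p.
  by rewrite dot_cross_cross c1 cp; ring.
have [x [y qE]] : exists x y, q = x *: p + y *: cross c p.
  exists (dot p q / dot p p), (dot (cross c p) q / dot p p).
  apply: (scalerI p0); rewrite (planar_decomposition c1 cp cq) scalerDr !scalerA.
  by congr (_ *: _ + _ *: _); rewrite mulrC divfK.
have [|t [t0 cost sint]] := @cos_sin_surj R x y; last first.
  by exists t; rewrite cost sint.
apply: (mulIf p0); rewrite mul1r -[RHS]qq qE.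
rewrite !(dotDl, dotDr, dotZl, dotZr) (dotC (cross c p) p) dot_crossr w2.
by ring.
Qed.

(** Projecting to the plane orthogonal to [c] reduces this to [planar_polar]. A suitable angle thus
    exists, and the value chosen by [xget] is not the default. *)
Lemma rotation_angleP z u : dot z z != dot c z ^+ 2 ->
    dot u u = dot z z -> dot c u = dot c z ->
  0 <= rotation_angle c z u < 2 * pi /\
  rotation c (rotation_angle c z u) z = u.
Proof.
move=> z0 uz cuz; set h := dot c z in z0 cuz *.
pose p := z - h *: c; pose q := u - h *: c.
have cp : dot c p = 0 by rewrite dotBr dotZr c1 -/h; ring.
have cq : dot c q = 0 by rewrite dotBr dotZr c1 cuz; ring.
have pp : dot p p = dot z z - h ^+ 2.
  by rewrite !(dotBl, dotBr, dotZl, dotZr) (dotC z) c1 -/h; ring.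
have qq : dot q q = dot p p.
  by rewrite pp !(dotBl, dotBr, dotZl, dotZr) (dotC u) c1 uz cuz; ring.
have p0 : dot p p != 0 by rewrite pp subr_eq0.
have [t [t0 qE]] := planar_polar cp cq qq p0.
suff <- : rotation c t z = u by rewrite rotation_angleE.
rewrite /rotation; have -> : cross c z = cross c p.
  by rewrite crossBr crossZr crossvv scaler0 subr0.
rewrite -[u](subrK (h *: c)) -/q qE -/h.
by apply/colP => i; rewrite !mxE; ring.
Qed.

Lemma enorm_subr_eq u v : dot u u = dot v v ->
  (enorm (c - u) = enorm (c - v)) <-> (dot c u = dot c v).
Proof.
move=> uv; rewrite /enorm !dot_subr2 uv; split=> [|-> //].
move=> /(congr1 (fun x => x ^+ 2)).
by rewrite -uv -dot_subr2 uv -dot_subr2 !sqr_sqrtr ?dot_ge0 // !dot_subr2 uv; lra.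
Qed.

Lemma circumcenter_dot T : spheric_triangle T -> circumcenter T c ->
  forall j, [/\ dot (T j) (T j) = 1, dot c (T j) = dot c (T 0) &
                dot (T j) (T j) != dot c (T j) ^+ 2].
Proof.
move=> [Ts Tinj] [_ Tc _].
have T1 j : dot (T j) (T j) = 1 by apply/on_sphereP.
have Th j : dot c (T j) = dot c (T 0) by apply/enorm_subr_eq; rewrite ?T1.
move=> j; split; rewrite // Th T1; apply/eqP => h1.
(* If one vertex were on the axis, all would be the same pole, against injectivity. *)
have TE i : T i = dot c (T 0) *: c.
  apply/eqP; rewrite -subr_eq0; apply/eqP/dot_eq0.
  by rewrite !(dotBl, dotBr, dotZl, dotZr) (dotC (T i) c) c1 T1 (Th i);
    ring: (esym h1).
by have /Tinj : T 0 = T 1 by rewrite (TE 1) -(TE 0).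
Qed.

Lemma angle_vector_bounds T (a := angle_vector c T) :
    spheric_triangle T -> circumcenter T c ->
  (forall j, 0 < a j 0 < 2 * pi) /\ \sum_j a j 0 = 2 * pi.
Proof.
move=> sT cT; have Tdot := circumcenter_dot sT cT.
have aT j : 0 <= a j 0 < 2 * pi /\ rotation c (a j 0) (T j) = T (j + 1).
  have [T1 Th Tn] := Tdot j; have [U1 Uh _] := Tdot (j + 1).
  by rewrite mxE; apply: rotation_angleP; rewrite // ?U1 ?T1 ?Uh ?Th.
(* A zero angle would identify two consecutive vertices. *)
have a0 j : 0 < a j 0 < 2 * pi.
  have [/andP[aj0 ->] rj] := aT j; rewrite andbT lt_neqAle aj0 andbT.
  apply: contraPneq rj => <-; rewrite rotation0 => /(proj2 sT).
  by case: (ord3P j) => ->.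
split=> //; rewrite sum_ord3.
have [T1 _ Tn] := Tdot 0.
have e1 : T 1 = rotation c (a 0 0) (T 0) by rewrite (proj2 (aT 0)) add0r.
have e2 : T 2 = rotation c (a 0 0 + a 1 0) (T 0).
  by rewrite addrC -rotationD -e1 (proj2 (aT 1)) ord3D.
(* Going once through the three vertices returns to [T 0], so the cosine of the total angle is 1. *)
have e3 : rotation c (a 0 0 + a 1 0 + a 2 0) (T 0) = T 0.
  by rewrite addrC -rotationD -e2 (proj2 (aT 2)) ord3D.
apply/eqP; rewrite -angle_sum_2pi ?a0 //.
  have [_ _] := cT; rewrite /counterclockwise_around e1 e2 dot_cross_rotation.
  have -> : a 0 0 + a 1 0 - a 0 0 = a 1 0 by rewrite addrAC subrr add0r.
  by rewrite pmulr_lgt0 // off_axis_gt0.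
rewrite -subr_eq0 in Tn; apply: (mulIf Tn).
have := dot_rotation2 0 (a 0 0 + a 1 0 + a 2 0) (T 0).
by rewrite e3 rotation0 subr0 mul1r => h; rewrite [X in _ = X - _]h addrK.
Qed.

End Rotation.

(** * Existence of a triangle with prescribed angles *)

Section Construction.
Variables (R : realType) (c : 'cV[R]_3).
Hypothesis c1 : dot c c = 1.

Lemma constructed_around_exists (z a : 'cV[R]_3) : dot z z = 1 ->
    dot z z != dot c z ^+ 2 -> (forall j, 0 < a j 0) -> \sum_j a j 0 = 2 * pi ->
  exists T, constructed_around c (enorm (c - z)) a T.
Proof.
move=> z1 zc a_gt0; rewrite sum_ord3 => a_sum.
have [a0 a1 a2] : [/\ 0 < a 0 0, 0 < a 1 0 & 0 < a 2 0] by [].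
(* The vertices are the rotations of [z] by the partial sums of the angles; the total [2 * pi]
   closes the triangle. *)
pose theta (j : 'I_3) : R :=
  if j == 0 then 0 else if j == 1 then a 0 0 else a 0 0 + a 1 0.
have [th0 th1 th2] : [/\ theta 0 = 0, theta 1 = a 0 0 & theta 2 = a 0 0 + a 1 0].
  by [].
pose T j := rotation c (theta j) z.
have TD j : T (j + 1) = rotation c (a j 0) (T j).
  rewrite /T rotationD //; case: (ord3P j) => ->; rewrite ?ord3D ?add0r.
  - by rewrite th0 th1 addr0.
  - by rewrite th1 th2 addrC.
  - by rewrite th0 th2 addrC a_sum rotation2pi rotation0.
have Tdot j : dot (T j) (T j) = dot z z by rewrite dot_rotationvv.
have Tc j : dot c (T j) = dot c z by rewrite dot_rotation.
have Tr j : enorm (c - T j) = enorm (c - z) by apply/enorm_subr_eq.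
have aT : angle_vector c T = a.
  apply/colP => j; rewrite mxE TD rotation_angleE ?Tdot ?Tc //.
  by case: (ord3P j) => ->; lra.
exists T; split=> //.
  split=> [j|i j /rotation_inj]; first by apply/on_sphereP; rewrite Tdot.
  (* The partial sums increase strictly within [[0, 2 * pi[], so distinct indices give distinct
     points. *)
  move=> /(_ c1 zc).
  by case: (ord3P i) => ->; case: (ord3P j) => -> //;
    rewrite ?th0 ?th1 ?th2 ltr_norml => tij; suff: False by []; lra.
split; [exact/on_sphereP|by move=> i j; rewrite !Tr|].
rewrite /counterclockwise_around [T 0]/T th0 rotation0 /T th1 th2.
have a01 : a 0 0 + a 1 0 - a 0 0 = a 1 0 by rewrite addrAC subrr add0r.
rewrite dot_cross_rotation // a01 pmulr_lgt0 ?off_axis_gt0 //.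
have cS : cos (a 0 0 + a 1 0 + a 2 0) = 1 by rewrite a_sum mulr_natl cos2pi.
by rewrite (@angle_sum_2pi _ _ _ (a 2 0)) //; lra.
Qed.

End Construction.

(** * Contraction of sum-zero vectors by the angle matrix *)

Section AngleMatrix.
Variables (R : realType) (k : nat).
Hypothesis k_ge2 : (2 <= k)%N.
Local Notation A := (angle_matrix R k).
Implicit Types a b : 'cV[R]_3.

Lemma angle_matrix_mulE a j :
  (A *m a) j 0 = (1 - k%:R^-1) * a j 0 + k%:R^-1 * a (j + 1) 0.
Proof.
have k0 : k%:R != 0 :> R by rewrite pnatr_eq0; case: k k_ge2.
have -> : 1 - k%:R^-1 = (k%:R - 1) / k%:R :> R by field.
rewrite mxE sum_ord3 !mxE.
case: (ord3P j) => ->; rewrite ?ord3D ?add0r /=; ring.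
Qed.

Lemma invk_bounds : 0 < (k%:R^-1 : R) <= 2^-1.
Proof.
by rewrite invr_gt0 ltr0n lef_pV2 ?posrE ?ltr0n ?ler_nat //; case: k k_ge2.
Qed.

Lemma angle_matrix_gt0 a : (forall j, 0 < a j 0) -> forall j, 0 < (A *m a) j 0.
Proof.
move=> a0 j; rewrite angle_matrix_mulE; have /andP[k0 k2] := invk_bounds.
by rewrite addr_gt0 // mulr_gt0 //; lra.
Qed.

Lemma sum_angle_matrix a : \sum_j (A *m a) j 0 = \sum_j a j 0.
Proof. by rewrite !sum_ord3 !angle_matrix_mulE !ord3D add0r; ring. Qed.

Lemma angle_matrix_const x : A *m const_mx x = const_mx x :> 'cV[R]_3.
Proof. by apply/colP => j; rewrite angle_matrix_mulE !mxE; ring. Qed.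

(** When the entries sum to zero, the sum of the products [b j 0 * b (j + 1) 0] is [- dot b b / 2],
    so the cross terms are also a multiple of [dot b b]. *)
Lemma dot_angle_matrix b (q := 1 - 3 * (1 - k%:R^-1) * k%:R^-1 : R) :
  \sum_j b j 0 = 0 -> dot (A *m b) (A *m b) = q * dot b b.
Proof.
rewrite sum_ord3 => b0; rewrite !dot3E !angle_matrix_mulE !ord3D add0r /q.
have -> : b 2 0 = - b 0 0 - b 1 0 by lra.
by ring.
Qed.

Lemma angle_matrix_exprS n a : A ^+ n.+1 *m a = A *m (A ^+ n *m a).
Proof. by rewrite exprS mulmxA. Qed.

Lemma angle_matrix_expr_gt0 n a : (forall j, 0 < a j 0) ->
  forall j, 0 < (A ^+ n *m a) j 0.
Proof.
move=> a0; elim: n => [|n IHn]; first by rewrite expr0 mul1mx.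
by rewrite angle_matrix_exprS; apply: angle_matrix_gt0.
Qed.

Lemma sum_angle_matrix_expr n a : \sum_j (A ^+ n *m a) j 0 = \sum_j a j 0.
Proof.
elim: n => [|n IHn]; first by rewrite expr0 mul1mx.
by rewrite angle_matrix_exprS sum_angle_matrix.
Qed.

Lemma angle_matrix_expr_const n x : A ^+ n *m const_mx x = const_mx x :> 'cV[R]_3.
Proof.
elim: n => [|n IHn]; first by rewrite expr0 mul1mx.
by rewrite angle_matrix_exprS IHn angle_matrix_const.
Qed.

Lemma angle_matrix_expr_cvg0 b : \sum_j b j 0 = 0 ->
  enorm (A ^+ n *m b) @[n --> \oo] --> (0 : R).
Proof.
move=> b0; pose q : R := 1 - 3 * (1 - k%:R^-1) * k%:R^-1.
have /andP[k0 k2] := invk_bounds.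
have q0 : 0 <= q by rewrite /q; nra.
have q1 : q < 1 by rewrite /q; nra.
(* The iterates keep sum zero, so the contraction identity applies at each step and the norms form a
   geometric sequence. *)
have Ab n : enorm (A ^+ n *m b) = enorm b * Num.sqrt q ^+ n.
  elim: n => [|n IHn]; first by rewrite expr0 mul1mx mulr1.
  rewrite angle_matrix_exprS /enorm dot_angle_matrix ?sum_angle_matrix_expr //.
  by rewrite sqrtrM // -/(enorm _) IHn exprS mulrCA.
under eq_fun do rewrite Ab.
apply: cvg_geometric; rewrite ger0_norm ?sqrtr_ge0 //.
by rewrite -[ltRHS]sqrtr1 ltr_sqrt.
Qed.

End AngleMatrix.

Theorem theorem4 (R : realType) (k : nat) (hk : (2 <= k)%N)
    (D0 : 'I_3 -> 'cV[R]_3) (c : 'cV[R]_3)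
    (hD0 : spheric_triangle D0) (hc : circumcenter D0 c) :
  let alpha := fun n : nat => angle_matrix R k ^+ n *m angle_vector c D0 in
  let r := enorm (c - D0 0) in
  (forall n, exists T, constructed_around c r (alpha n) T) /\
  (forall D : nat -> 'I_3 -> 'cV[R]_3,
     D 0%N = D0 ->
     (forall n, constructed_around c r (alpha n) (D n)) ->
     converges_to_regular c D).
Proof.
move=> alpha r; have c1 : dot c c = 1 by case: hc => /on_sphereP.
have [a_bounds a_sum] := angle_vector_bounds c1 hD0 hc.
split=> [n|D _ DA].
  have [D1 _ Dc] := circumcenter_dot c1 hD0 hc 0.
  (* The first vertex of [D0] serves as starting point for every [n], which keeps all the triangles
     on one circle. *)
  apply: constructed_around_exists => //; last by rewrite sum_angle_matrix_expr.
  by apply: angle_matrix_expr_gt0 => // j; have /andP[] := a_bounds j.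
rewrite /converges_to_regular.
(* The regular angle vector is fixed by the matrix, so the deviation from it evolves linearly; its
   entries sum to [2 * pi - 3 * (2 * pi / 3) = 0]. *)
have DE n : angle_vector c (D n) - const_mx (2 * pi / 3) =
    angle_matrix R k ^+ n *m (angle_vector c D0 - const_mx (2 * pi / 3)).
  by have [_ _ _ ->] := DA n; rewrite mulmxBr angle_matrix_expr_const.
under eq_fun do rewrite DE.
apply: angle_matrix_expr_cvg0 => //.
move: a_sum; rewrite !sum_ord3 => a_sum; rewrite !mxE in a_sum *; lra.
Qed.
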